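(* Let $d$ be a positive integer and let $f$ be any $d$-tupling function. Then $f$ has cubic shells if and only if, for every integer $n>1$, $f$ has base-$n$ shells.
   Context: $\mathbb{N}$ denotes the non-negative integers. A $d$-tupling function is a bijection $f\colon\mathbb{N}^d\to\mathbb{N}$. A function $s\colon\mathbb{N}^d\to\mathbb{N}$ is a shell numbering for $f$ if for all $\mathbf{x},\mathbf{y}\in\mathbb{N}^d$, $s(\mathbf{x})<s(\mathbf{y})$ implies $f(\mathbf{x})<f(\mathbf{y})$. $f$ has cubic shells if $\max(x_1,\ldots,x_d)$ is a shell numbering for $f$. For an integer $n>1$ and $x\in\mathbb{N}$, $\operatorname{len}_n(x)=\lceil\log_n(x+1)\rceil$; $f$ has base-$n$ shells if $\max(\operatorname{len}_n(x_1),\ldots,\operatorname{len}_n(x_d))$ is a shell numbering for $f$. *)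

(* Defs.v *)
From HB Require Import structures.
From mathcomp Require Import all_boot all_order all_algebra.
From mathcomp Require Import reals exp.

Set Implicit Arguments.
Unset Strict Implicit.
Unset Printing Implicit Defensive.

Import Order.TTheory GRing.Theory Num.Theory.
Local Open Scope ring_scope.

Definition tupling (d : nat) (f : d.-tuple nat -> nat) : Prop := bijective f.

Definition shell_numbering (d : nat) (f s : d.-tuple nat -> nat) : Prop :=
  forall x y : d.-tuple nat, (s x < s y)%N -> (f x < f y)%N.

Definition cubic_shells (d : nat) (f : d.-tuple nat -> nat) : Prop :=
  shell_numbering f (fun x => (\max_(i < d) tnth x i)%N).

(* The ceiling of the base-n logarithm of x + 1. It is an integer which is
   nonnegative for 1 < n (see ceil_log_ge0), so taking the absolute value only
   casts it to nat. *)
Definition len (R : realType) (n x : nat) : nat :=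
  `|Num.ceil (ln (x.+1%:R : R) / ln (n%:R : R))|%N.

Lemma ceil_log_ge0 (R : realType) (n x : nat) : (1 < n)%N ->
  0 <= Num.ceil (ln (x.+1%:R : R) / ln (n%:R : R)).
Proof.
move=> n1; rewrite -[leLHS](@intrKceil R) le_ceil //.
by rewrite divr_ge0 // ln_ge0 // ler1n // ltnW.
Qed.

Definition base_shells (R : realType) (n d : nat) (f : d.-tuple nat -> nat)
    : Prop :=
  shell_numbering f (fun x => (\max_(i < d) len R n (tnth x i))%N).

(* Main.v *)
Require Import Defs.
From HB Require Import structures.
From mathcomp Require Import all_boot all_order all_algebra.
From mathcomp Require Import reals exp.

(** Since [len_n x <= k] iff [x < n ^ k], the base-[n] shells are unions of
    consecutive cubic shells. Conversely, for [a < b] some base [n] has a power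
    [n ^ k] with [a < n ^ k <= b], which separates the cubic shells [a] and [b]:
    take [n ^ k = b ^ 1] if [b > 1], and [2 ^ 0] if [b = 1]. *)

Import Order.TTheory GRing.Theory Num.Theory.

(** For an integer [k], a ceiling is at most [k] iff its argument is; clearing the positive
    denominator [ln n] leaves [ln (x + 1) <= ln (n ^ k)], and [ln] is increasing. *)
Lemma len_leq (R : realType) (n x k : nat) :
  1 < n -> (len R n x <= k) = (x < n ^ k).
Proof.
move=> n1.
have n0 : (0 < n%:R :> R)%R by rewrite ltr0n ltnW.
rewrite -lez_nat /len gez0_abs ?ceil_log_ge0 // ceil_le_int.
rewrite ler_pdivrMr ?ln_gt0 ?ltr1n // -[(k%:Z)%:~R%R]/(k%:R%R) mulr_natl.
by rewrite -lnXn // -natrX ler_ln ?ler_nat // posrE ltr0n ?expn_gt0 // ltnW.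
Qed.

Lemma bigmax_len_leq (R : realType) (d n k : nat) (x : d.-tuple nat) :
  1 < n ->
  (\max_(i < d) len R n (tnth x i) <= k) = (\max_(i < d) tnth x i < n ^ k).
Proof.
move=> n1; have nk : 0 < n ^ k by rewrite expn_gt0 ltnW.
(* [bigmax_leqP] treats non-strict bounds, so [< n ^ k] becomes [<= (n ^ k).-1]. *)
rewrite -[in RHS](prednK nk) ltnS.
apply/bigmax_leqP/bigmax_leqP => le_x i _; have := le_x i isT;
  by rewrite len_leq // -[in X in _ < X](prednK nk) ltnS.
Qed.

Lemma separating_power (a b : nat) :
  a < b -> exists n k, [/\ 1 < n, a < n ^ k & n ^ k <= b].
Proof.
case: b => [|[|b]] // ab; first by exists 2, 0.
by exists b.+2, 1; rewrite expn1.
Qed.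

Theorem theorem2p6 (R : realType) (d : nat) (hd : (0 < d)%N)
    (f : d.-tuple nat -> nat) (hf : tupling f) :
  cubic_shells f <-> (forall n : nat, (1 < n)%N -> base_shells R n f).
Proof.
split=> [cubic n n1 x y lt_xy | base x y /separating_power [n [k [n1 xk ky]]]].
  (* With [k] the base-[n] shell of [x], the power [n ^ k] exceeds the maximum of [x] but not that
     of [y]. *)
  apply: cubic; apply: (@leq_trans (n ^ \max_(i < d) len R n (tnth x i))).
    by rewrite -(bigmax_len_leq R).
  by rewrite leqNgt -(bigmax_len_leq R) // -ltnNge.
apply: (base n n1); apply: (@leq_ltn_trans k); first by rewrite bigmax_len_leq.
by rewrite ltnNge bigmax_len_leq // -leqNgt.
Qed.
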